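(* Let $\mathcal D=\{w\in\{0,1\}^*\mid |w|_0=|w|_1\text{ and }|w[1..i]|_0\le|w[1..i]|_1\text{ for all }1\le i\le|w|\}$ and let $L_{\mathcal D}=\mathcal D\cup\widetilde{\mathcal D}$, where $\widetilde{\mathcal D}$ is obtained from $\mathcal D$ by exchanging $0$ and $1$ in every word. Then $\mathcal G_{L_{\mathcal D}}$ is exactly the class of comparability graphs.
   Context: $|w|_a$ is the number of occurrences of the letter $a$ in $w$, and $w[1..i]$ is the prefix of $w$ of length $i$. A graph $G=(V,E)$ is a comparability graph if there is a (strict) partial order on $V$ such that distinct $u,v\in V$ are comparable if and only if $\{u,v\}\in E$. Graphs are finite, undirected and simple: $G=(V,E)$ with $V$ a finite non-empty set and $E\subseteq\binom{V}{2}$. A language $L\subseteq\{0,1\}^*$ is $0$-$1$-symmetric if it is invariant under the morphism exchanging $0$ and $1$ (the language $L_{\mathcal D}$ is). For distinct letters $u,v$ of an alphabet $V$, $h_{u,v}:V^*\to\{0,1\}^*$ is the monoid morphism with $u\mapsto 0$, $v\mapsto 1$, and $x\mapsto\lambda$ (empty word) for all other letters $x$. For a $0$-$1$-symmetric $L$ and a word $w\in V^*$ in which every letter of $V$ occurs, $G(L,w)$ is the graph with vertex set $V$ in which distinct $u,v$ are adjacent if and only if $h_{u,v}(w)\in L$. $\mathcal G_L$ is the class of all graphs $G=(V,E)$ with $G=G(L,w)$ for some $w\in V^*$ in which every letter of $V$ occurs. *)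

(* Defs.v *)
From mathcomp Require Import all_boot.

Set Implicit Arguments.
Unset Strict Implicit.
Unset Printing Implicit Defensive.

(* A finite simple graph with vertex set V, given by its adjacency relation. *)
Record graph (V : finType) := Graph {
  adj :> rel V;
  adj_sym : symmetric adj;
  adj_irr : irreflexive adj
}.

Definition comparability_graph (V : finType) (G : graph V) : Prop :=
  exists lt : rel V,
    [/\ irreflexive lt, transitive lt
      & forall u v : V, u != v -> (lt u v || lt v u) = adj G u v].

(* Words over {0,1} are boolean sequences, with false for 0 and true for 1. *)
Notation letter0 := false (only parsing).
Notation letter1 := true (only parsing).

Definition exchange01 (w : seq bool) : seq bool := map negb w.

Record symlang := SymLang {
  lang :> pred (seq bool);
  lang_sym : forall w, lang (exchange01 w) = lang w
}.

Definition hmor (V : eqType) (u v : V) (w : seq V) : seq bool :=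
  flatten [seq (if x == u then [:: letter0]
                else if x == v then [:: letter1] else [::]) | x <- w].

Lemma hmor_exchange (V : eqType) (u v : V) (w : seq V) :
  u != v -> hmor v u w = exchange01 (hmor u v w).
Proof.
move=> neq_uv; rewrite /hmor /exchange01; elim: w => //= x w ->.
rewrite map_cat; case: (x =P v) => [->|_]; last by case: (x == u).
by rewrite eq_sym (negbTE neq_uv).
Qed.

Section WordGraph.
Variables (V : finType) (L : symlang) (w : seq V).

Definition word_adj : rel V := fun u v => (u != v) && L (hmor u v w).

Fact word_adj_sym : symmetric word_adj.
Proof.
move=> u v; rewrite /word_adj eq_sym; case: eqVneq => //= neq_vu.
by rewrite (hmor_exchange _ neq_vu) lang_sym.
Qed.

Fact word_adj_irr : irreflexive word_adj.
Proof. by move=> u; rewrite /word_adj eqxx. Qed.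

Definition word_graph : graph V := Graph word_adj_sym word_adj_irr.

End WordGraph.

(* Equality of graphs on V is extensional equality of adjacency relations. *)
Definition graph_class (L : symlang) (V : finType) (G : graph V) : Prop :=
  exists w : seq V, (forall x : V, x \in w) /\ adj G =2 adj (word_graph L w).

Definition dyck : pred (seq bool) := fun w =>
  (count_mem letter0 w == count_mem letter1 w) &&
  all (fun i => count_mem letter0 (take i w) <= count_mem letter1 (take i w))
      (iota 1 (size w)).

(* As exchange01 is an involution, w lies in the image of dyck under it
   if and only if exchange01 w lies in dyck. *)
Definition dyck_exchanged : pred (seq bool) := fun w => dyck (exchange01 w).

Definition dyck_sym : pred (seq bool) := fun w => dyck w || dyck_exchanged w.

Fact dyck_sym_exchange w : dyck_sym (exchange01 w) = dyck_sym w.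
Proof.
by rewrite /dyck_sym /dyck_exchanged /exchange01 (mapK negbK) orbC.
Qed.

Definition LD : symlang := SymLang dyck_sym_exchange.

(* Main.v *)
(** For distinct letters, [h_{u,v}(w)] lies in [D] iff [u] and [v] occur equally
    often in [w] and no prefix of [w] has more [u]'s than [v]'s.  This relation
    is a strict partial order on the letters of [w]: it is clearly transitive,
    and two letters related both ways would have the same count in every prefix,
    which is impossible.  Conversely, a poset is represented by concatenating
    enough linear extensions, each listing larger elements first: [u] is then
    dominated by [v] iff [v] precedes [u] in every block.  One block per element
    [a] suffices, namely the one listing the elements above [a] as early as
    possible: [a] precedes there every [v] that is not above [a]. *)
Require Import Defs.
From mathcomp Require Import all_boot.

Set Implicit Arguments.
Unset Strict Implicit.
Unset Printing Implicit Defensive.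

(** All [i] are allowed, so no range has to be carried along: [i = 0] is trivial, and lengths past
    the end repeat the whole word. *)
Definition dominated (T : eqType) (u v : T) (w : seq T) : Prop :=
  forall i, count_mem u (take i w) <= count_mem v (take i w).

Lemma dyckP (b : seq bool) :
  reflect (count_mem false b = count_mem true b /\ dominated false true b)
          (dyck b).
Proof.
apply: (iffP andP) => [[/eqP eq_b /allP le_b]|[eq_b le_b]].
  split=> // i; have [lt_b_i|le_i_b] := ltnP (size b) i.
    by rewrite take_oversize ?eq_b // ltnW.
  case: i le_i_b => [|i] le_i_b; first by rewrite take0.
  by apply: le_b; rewrite mem_iota add1n ltnS.
by split; [apply/eqP | apply/allP=> i _; apply: le_b].
Qed.

Section Hmor.
Variables (T : eqType) (u v : T).
Hypothesis neq_uv : u != v.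

Lemma hmor_cat (s t : seq T) : hmor u v (s ++ t) = hmor u v s ++ hmor u v t.
Proof. by rewrite /hmor map_cat flatten_cat. Qed.

Lemma count_hmor0 (s : seq T) : count_mem false (hmor u v s) = count_mem u s.
Proof.
elim: s => //= x s IHs; rewrite -IHs /hmor /= count_cat.
by case: (x == u) => //; case: (x == v).
Qed.

Lemma count_hmor1 (s : seq T) : count_mem true (hmor u v s) = count_mem v s.
Proof.
elim: s => //= x s IHs; rewrite -IHs /hmor /= count_cat.
case: (x =P u) => [->|_]; first by rewrite (negbTE neq_uv).
by case: (x == v).
Qed.

Lemma hmor_take (s : seq T) i :
  hmor u v (take i s) = take (size (hmor u v (take i s))) (hmor u v s).
Proof. by rewrite -{3}(cat_take_drop i s) hmor_cat take_size_cat. Qed.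

(** Erasing letters changes lengths, but each letter yields at most one bit, so no prefix of the
    image stops inside the image of a letter. *)
Lemma take_hmor (s : seq T) i :
  exists j, take i (hmor u v s) = hmor u v (take j s).
Proof.
elim: s i => [|x s IHs] [|i]; try by exists 0; rewrite take0.
set b := hmor u v [:: x].
have ->: hmor u v (x :: s) = b ++ hmor u v s by rewrite -hmor_cat.
have [j def_j] := IHs (i.+1 - size b).
exists j.+1; rewrite take_cat /= -cat1s hmor_cat -/b -def_j.
have: size b <= 1 by rewrite /b /hmor /=; case: (x == u); case: (x == v).
by case: ltnP => // lt_i_b le_b1; have := leq_trans lt_i_b le_b1.
Qed.

Lemma dyck_hmorP (w : seq T) :
  reflect (count_mem u w = count_mem v w /\ dominated u v w)
          (dyck (hmor u v w)).
Proof.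
apply: (iffP (dyckP _)); rewrite count_hmor0 count_hmor1 => -[-> dom_w].
  split=> // i; rewrite -count_hmor0 -count_hmor1 hmor_take; exact: dom_w.
split=> // i; have [j ->] := take_hmor w i.
by rewrite count_hmor0 count_hmor1.
Qed.

Lemma dyck_sym_hmor (w : seq T) :
  dyck_sym (hmor u v w) = dyck (hmor u v w) || dyck (hmor v u w).
Proof. by rewrite /dyck_sym /dyck_exchanged (hmor_exchange _ neq_uv). Qed.

End Hmor.

Lemma dominated_trans (T : eqType) (w : seq T) (u v x : T) :
  dominated u v w -> dominated v x w -> dominated u x w.
Proof. by move=> uv vx i; apply: leq_trans (uv i) (vx i). Qed.

Lemma dominated_anti (T : eqType) (w : seq T) (u v : T) :
  u \in w -> dominated u v w -> dominated v u w -> u = v.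
Proof.
move=> w_u uv vu; have eq_uv i : count_mem u (take i w) = count_mem v (take i w).
  by apply/eqP; rewrite eqn_leq uv vu.
(* The last letter of the prefix ending at the first [u] adds one [u], hence also one [v]. *)
have := eq_uv (index u w).+1; rewrite (take_nth u) ?index_mem // nth_index //.
rewrite -cats1 !count_cat eq_uv /= eqxx !addn0 => /addnI.
by case: eqP.
Qed.

(** Once [s] is read, both counts have grown equally, so a longer prefix compares as its part in [t]
    does. *)
Lemma dominated_cat (T : eqType) (u v : T) (s t : seq T) :
  count_mem u s = count_mem v s ->
  dominated u v (s ++ t) <-> dominated u v s /\ dominated u v t.
Proof.
move=> eq_s; split=> [dom_st | [dom_s dom_t] i].
  split=> i.
    have [lt_i_s|le_s_i] := ltnP i (size s); last by rewrite take_oversize ?eq_s.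
    by have := dom_st i; rewrite take_cat lt_i_s.
  have := dom_st (size s + i).
  by rewrite take_cat ltnNge leq_addr /= addKn !count_cat eq_s leq_add2l.
by rewrite take_cat; case: ifP => _; rewrite ?count_cat ?eq_s ?leq_add2l.
Qed.

(** Each count jumps from 0 to 1 just after the index of its letter; the prefix ending at [u]
    decides. *)
Lemma dominated_uniq (T : eqType) (u v : T) (s : seq T) :
  uniq s -> u \in s -> v \in s ->
  dominated u v s <-> index v s <= index u s.
Proof.
move=> uniq_s s_u s_v; have count_take x i : x \in s ->
    count_mem x (take i s) = (index x s < i).
  by move=> s_x; rewrite count_uniq_mem ?take_uniq // in_take.
split=> [/(_ (index u s).+1) | le_vu i]; rewrite !count_take //.
  by rewrite ltnSn ltnS lt0b.
by case: (ltnP _ i) => // lt_ui; rewrite (leq_ltn_trans le_vu lt_ui).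
Qed.

(** Both letters occur once in every block, so the counts balance and [dominated_cat] splits off one
    block at a time. *)
Lemma dominated_flatten (T : eqType) (u v : T) (ss : seq (seq T)) :
  (forall s, s \in ss -> [/\ uniq s, u \in s & v \in s]) ->
  dominated u v (flatten ss) <->
  (forall s, s \in ss -> index v s <= index u s).
Proof.
elim: ss => [|s ss IHss] ss_uv //=.
have [uniq_s s_u s_v] := ss_uv s (mem_head s ss).
have {}IHss := IHss (fun t ss_t => ss_uv t (mem_behead (s := s :: ss) ss_t)).
have eq_s: count_mem u s = count_mem v s by rewrite !count_uniq_mem ?s_u ?s_v.
have [dom_cat cat_dom] := dominated_cat (flatten ss) eq_s.
split=> [/dom_cat[/(dominated_uniq uniq_s s_u s_v) le_s /IHss le_ss] t | le_sss].
  by rewrite inE => /predU1P[->|/le_ss].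
apply: cat_dom; split; first by apply/dominated_uniq/le_sss/mem_head.
by apply/IHss => t ss_t; apply: le_sss; rewrite inE ss_t orbT.
Qed.

Lemma sorted_key_index (T : eqType) (key : T -> nat) (s : seq T) (x y : T) :
  sorted (relpre key leq) s -> x \in s -> y \in s ->
  key x < key y -> index x s < index y s.
Proof.
move=> s_sorted s_x s_y lt_xy; rewrite ltnNge leq_eqVlt negb_or.
apply/andP; split.
  by apply: contraTneq lt_xy => /(index_inj y s_y s_x) ->; rewrite ltnn.
apply: contraL lt_xy => lt_yx; rewrite -leqNgt.
have key_tr : transitive (relpre key leq) by move=> ? ? ?; apply: leq_trans.
exact: (sorted_ltn_index key_tr s_sorted).
Qed.

Section Realizer.
Variables (V : finType) (lt : rel V).
Hypotheses (lt_irr : irreflexive lt) (lt_tr : transitive lt).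

(** Strictly decreasing along [lt], so that sorting by it gives a linear extension with larger
    elements first. *)
Let height (x : V) := #|[pred y | lt x y]|.
Let ext := sort (relpre height leq) (enum V).
Let up (a x : V) := (x == a) || lt a x.

Definition block (a : V) : seq V :=
  filter (up a) ext ++ filter (predC (up a)) ext.

Lemma mem_ext x : x \in ext.
Proof. by rewrite mem_sort mem_enum. Qed.

Lemma perm_block a : perm_eq (block a) (enum V).
Proof. by rewrite /block (perm_trans (permEl (perm_filterC _ _))) ?perm_sort. Qed.

Lemma uniq_block a : uniq (block a).
Proof. by rewrite (perm_uniq (perm_block a)) enum_uniq. Qed.

Lemma mem_block a x : x \in block a.
Proof. by rewrite (perm_mem (perm_block a)) mem_enum. Qed.

Lemma height_lt x y : lt x y -> height y < height x.
Proof.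
move=> lt_xy; apply: proper_card; apply/properP; split.
  by apply/subsetP=> z; rewrite !inE; apply: lt_tr.
by exists y; rewrite !inE ?lt_irr.
Qed.

Lemma index_filter_ext (p : pred V) x y :
  lt x y -> p x -> p y -> index y (filter p ext) < index x (filter p ext).
Proof.
move=> lt_xy p_x p_y; apply: (@sorted_key_index _ height).
- apply: sorted_filter; first by move=> ? ? ?; apply: leq_trans.
  by apply: sort_sorted => ? ?; apply: leq_total.
- by rewrite mem_filter p_y mem_ext.
- by rewrite mem_filter p_x mem_ext.
exact: height_lt.
Qed.

(** Whatever lies above a member of [up a] is a member too, so moving this up-set to the front
    reverses no related pair. *)
Lemma index_block_lt a x y : lt x y -> index y (block a) < index x (block a).
Proof.
move=> lt_xy; rewrite /block !index_cat !mem_filter !mem_ext !andbT.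
have [up_x|up'x] := boolP (up a x).
  have up_y : up a y.
    apply/orP; right; case/predU1P: up_x => [<- //|lt_ax].
    exact: lt_tr lt_ax lt_xy.
  by rewrite up_y index_filter_ext.
case: ifP => up_y; last by rewrite ltn_add2l index_filter_ext //= up_y.
by apply: ltn_addr; rewrite index_mem mem_filter up_y mem_ext.
Qed.

(** In its own block [x] belongs to the front piece, whereas [y], neither equal to [x] nor above it,
    falls into the back piece. *)
Lemma index_block_nlt x y :
  x != y -> ~~ lt x y -> index x (block x) < index y (block x).
Proof.
move=> neq_xy nlt_xy; rewrite /block !index_cat !mem_filter !mem_ext !andbT.
rewrite /up eqxx /= eq_sym (negbTE neq_xy) (negbTE nlt_xy) /=.
by apply: ltn_addr; rewrite index_mem mem_filter eqxx mem_ext.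
Qed.

Definition realizer : seq V := flatten [seq block a | a <- enum V].

Lemma mem_realizer x : x \in realizer.
Proof.
apply/flattenP; exists (block x); last exact: mem_block.
by rewrite map_f ?mem_enum.
Qed.

Lemma count_realizer x : count_mem x realizer = #|V|.
Proof.
rewrite /realizer cardE; elim: (enum V) => //= a s IHs.
by rewrite count_cat IHs count_uniq_mem ?uniq_block // mem_block.
Qed.

Lemma dyck_realizer x y : x != y -> dyck (hmor x y realizer) = lt x y.
Proof.
move=> neq_xy.
have blocks s : s \in [seq block a | a <- enum V] -> [/\ uniq s, x \in s & y \in s].
  by case/mapP=> a _ ->; rewrite uniq_block !mem_block.
apply/(dyck_hmorP neq_xy)/idP => [[_ /(dominated_flatten blocks) le_yx]|lt_xy].
  (* Were [lt x y] false, [block x] would violate the index bound. *)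
  apply: contraT => /(index_block_nlt neq_xy); rewrite ltnNge le_yx //.
  by rewrite map_f ?mem_enum.
split; first by rewrite !count_realizer.
by apply/(dominated_flatten blocks) => _ /mapP[a _ ->]; apply/ltnW/index_block_lt.
Qed.

End Realizer.

Theorem theorem28 (V : finType) (V_nonempty : 0 < #|V|) (G : graph V) :
  graph_class LD G <-> comparability_graph G.
Proof.
split=> [[w [w_all adjG]] | [lt [lt_irr lt_tr ltG]]].
  (* The conjunct [u != v] gives irreflexivity at once and lets [dyck_hmorP] apply; the price is
     proving [u != x] for transitivity. *)
  exists (fun u v => (u != v) && dyck (hmor u v w)); split=> [u | v u x | u v neq_uv].
  - by rewrite eqxx.
  - case/andP=> neq_uv /(dyck_hmorP neq_uv)[eq_uv dom_uv].
    case/andP=> neq_vx /(dyck_hmorP neq_vx)[eq_vx dom_vx].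
    (* If [x] were [u], then [u] and [v] would dominate each other, which forces [u = v] because [u]
       occurs in [w]. *)
    have neq_ux : u != x.
      apply: contraNneq neq_uv => eq_ux; rewrite -eq_ux in dom_vx.
      by apply/eqP/(dominated_anti (w_all u)).
    rewrite neq_ux; apply/(dyck_hmorP neq_ux); rewrite eq_uv.
    by split=> //; apply: dominated_trans dom_vx.
  by rewrite adjG /= /word_adj /= dyck_sym_hmor // (eq_sym v) neq_uv.
exists (realizer lt); split=> [|u v]; first exact: mem_realizer.
rewrite /= /word_adj /=; have [->|neq_uv] := eqVneq u v; first by rewrite adj_irr.
by rewrite -ltG //= dyck_sym_hmor // !dyck_realizer // eq_sym.
Qed.
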